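(* Let $G$ be the finite Coxeter group of type $D_n$, realized as the subgroup $\{[a_1,\dots,a_n;\sigma]\in C_2\wr S_n \mid \prod_i a_i=1\}$ of $C_2\wr S_n$. (i) If $n$ is even, then $r\cdot G=H(X_1\cup X_2)$, where $H\cong C_2\times S_n$ is a subgroup of $G$ conjugate to $H_0=\{[1,1,\dots,1;\sigma],\,[-1,-1,\dots,-1;\rho]\mid \sigma,\rho\in S_n\}$, $X_1,X_2$ are the two conjugacy classes of $G$ of signed partition $(n)$, and $r=2(n-1)!$. (ii) If $n$ is odd, then $r\cdot G=HX_1$, where $H\cong S_n$ is a subgroup of $G$ conjugate to $H_1=\{[1,1,\dots,1;\sigma]\mid\sigma\in S_n\}$, $X_1$ is the conjugacy class of $G$ of signed partition $(n)$, and $r=(n-1)!$.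
   Context: $C_2=\{\pm1\}$, and $C_2\wr S_n=C_2^n\rtimes S_n$ (the Coxeter group of type $B_n$) consists of the elements $[a_1,\dots,a_n;\sigma]$ with $a_i\in\{\pm1\}$, $\sigma\in S_n$, with multiplication $$[a_1,\dots,a_n;\sigma]\cdot[b_1,\dots,b_n;\tau]=[a_1b_{\sigma(1)},\dots,a_nb_{\sigma(n)};\sigma\tau],$$ where products in $S_n$ are taken from left to right, i.e. $(\sigma\tau)(i)=\tau(\sigma(i))$. The group of type $D_n$ is the index-two subgroup given by $\prod_i a_i=1$. The signed partition of $[a_1,\dots,a_n;\sigma]$ has, for each cycle $(k_1,\dots,k_m)$ of $\sigma$, the part $m$ if $\prod_i a_{k_i}=1$ and the part $\bar m$ if $\prod_i a_{k_i}=-1$. The elements of signed partition $(n)$ are the $[b_1,\dots,b_n;\tau]$ with $\tau$ an $n$-cycle and $\prod_i b_i=1$. They form a single conjugacy class of $C_2\wr S_n$; for $n$ even this set is the union of two distinct conjugacy classes of the type $D_n$ group, and for $n$ odd it is a single conjugacy class of it. For a finite group $G$, subsets $A,B\subseteq G$ and a positive integer $r$, the notation $r\cdot G=AB$ means that for every $g\in G$ there are exactly $r$ pairs $(a,b)\in A\times B$ with $ab=g$. *)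

(* Defs.v *)
From HB Require Import structures.
From mathcomp Require Import all_boot all_order all_algebra all_fingroup.
Set Implicit Arguments.
Unset Strict Implicit.
Unset Printing Implicit Defensive.

Local Open Scope group_scope.

(* C_2 = {1, -1} is encoded by bool: [b] stands for (-1) ^+ b, so that false  *)
(* is 1, true is -1, and products of signs are sums [addb].                   *)

(* [a_1, ..., a_n; sigma] in C_2 wr S_n, with indices in 'I_n.                *)
Record signed_perm (n : nat) :=
  SignedPerm { signs : {ffun 'I_n -> bool}; uperm : 'S_n }.

Section SignedPermGroup.
Variable n : nat.
Implicit Types g h : signed_perm n.

Definition pair_of_sperm g := (signs g, uperm g).
Definition sperm_of_pair (p : {ffun 'I_n -> bool} * 'S_n) :=
  SignedPerm p.1 p.2.

Lemma pair_of_spermK : cancel pair_of_sperm sperm_of_pair.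
Proof. by case. Qed.

HB.instance Definition _ := Finite.copy (signed_perm n) (can_type pair_of_spermK).

Lemma sperm_eqP g h :
  signs g =1 signs h -> uperm g = uperm h -> g = h.
Proof. by case: g h => [a s] [b t] /= /ffunP -> ->. Qed.

(* In mathcomp, (s * t) i = t (s i) for permutations s and t.                 *)
Definition sperm_mul g h :=
  SignedPerm [ffun i => signs g i (+) signs h (uperm g i)] (uperm g * uperm h).
Definition sperm_one : signed_perm n := SignedPerm [ffun=> false] 1.
Definition sperm_inv g :=
  SignedPerm [ffun i => signs g ((uperm g)^-1 i)] (uperm g)^-1.

Lemma sperm_mulA : associative sperm_mul.
Proof.
move=> g h k; apply: sperm_eqP => [i|] /=; last by rewrite mulgA.
by rewrite !ffunE permM addbA.
Qed.

Lemma sperm_mul1 : left_id sperm_one sperm_mul.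
Proof.
move=> g; apply: sperm_eqP => [i|] /=; last by rewrite mul1g.
by rewrite !ffunE perm1 addFb.
Qed.

Lemma sperm_mulV : left_inverse sperm_one sperm_inv sperm_mul.
Proof.
move=> g; apply: sperm_eqP => [i|] /=; last by rewrite mulVg.
by rewrite !ffunE addbb.
Qed.

HB.instance Definition _ :=
  Finite_isGroup.Build (signed_perm n) sperm_mulA sperm_mul1 sperm_mulV.

Definition sign_prod (C : {set 'I_n}) g := \big[addb/false]_(i in C) signs g i.

(* The part m is encoded by (m, false) and the part \bar m by (m, true).      *)
(* The order of the parts is irrelevant: compare with [perm_eq].              *)
Definition signed_partition g : seq (nat * bool) :=
  [seq (#|C|, sign_prod C g) | C : {set 'I_n} <- enum (porbits (uperm g))].

Definition type_D : {set signed_perm n} :=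
  [set g | sign_prod [set: 'I_n] g == false].

Lemma type_D_group_set : group_set type_D.
Proof.
apply/group_setP; split=> [|g h].
  by rewrite inE /sign_prod big1 // => i _; rewrite ffunE.
rewrite !inE /sign_prod => /eqP Dg /eqP Dh; apply/eqP.
under eq_bigr do rewrite ffunE.
rewrite big_split /= Dg -[RHS]Dh addFb.
rewrite [RHS](reindex_inj (@perm_inj _ (uperm g))) /=.
by apply: eq_bigl => i; rewrite !inE.
Qed.
Canonical type_D_group := group type_D_group_set.

Definition pm_Sym : {set signed_perm n} :=
  [set g | (signs g == [ffun=> false]) || (signs g == [ffun=> true])].

Lemma pm_Sym_group_set : group_set pm_Sym.
Proof.
apply/group_setP; split=> [|g h]; first by rewrite inE eqxx.
rewrite !inE => /orP[] /eqP Eg /orP[] /eqP Eh; apply/orP;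
  by [left; apply/eqP/ffunP=> i; rewrite !ffunE Eg Eh !ffunE
     |right; apply/eqP/ffunP=> i; rewrite !ffunE Eg Eh !ffunE].
Qed.
Canonical pm_Sym_group := group pm_Sym_group_set.

Definition pure_Sym : {set signed_perm n} := [set g | signs g == [ffun=> false]].

Lemma pure_Sym_group_set : group_set pure_Sym.
Proof.
apply/group_setP; split=> [|g h]; first by rewrite inE eqxx.
rewrite !inE => /eqP Eg /eqP Eh.
by apply/eqP/ffunP=> i; rewrite !ffunE Eg Eh !ffunE.
Qed.
Canonical pure_Sym_group := group pure_Sym_group_set.

Definition classes_of_signed_partition
    (G : {group signed_perm n}) (s : seq (nat * bool)) :=
  [set X in classes G | [forall g in X, perm_eq (signed_partition g) s]].

End SignedPermGroup.

(* The relation written r . G = A B for subsets A, B of G and positive r.     *)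
Definition factorization (gT : finGroupType) (r : nat) (G : {group gT})
    (A B : {set gT}) : Prop :=
  [/\ (0 < r)%N, A \subset G, B \subset G
    & forall g, g \in G -> #|[set p in setX A B | p.1 * p.2 == g]| = r].

(* Main.v *)
Require Import Defs.
From mathcomp Require Import all_boot all_order all_algebra all_fingroup.

(** Let W be the wreath product of C_2 by S_n, let D be its subgroup of type
    D_n, and let P be the set of elements of signed partition (n): those whose
    underlying permutation is an n-cycle and whose signs have product 1.

    The sign product is a morphism from W to C_2 with kernel D.  So once h and
    g are in D, so is h^-1 g, and it lies in P as soon as its underlying
    permutation is an n-cycle: the signs of g and h are then irrelevant.  Take
    for K the group of the [e, ..., e; s], with s in S_n and e in a group E of
    signs such that K lies in D: E = C_2 for n even, E = 1 for n odd.  For a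
    given g in D, the factorizations g = h p with h in K and p in P correspond
    to the pairs of a sign in E and an n-cycle, and there are (n-1)! n-cycles
    because the centralizer of one of them is regular, hence of order n
    ([factorization_const], [card_full_cycle]).  As P is stable under
    conjugation, K may be replaced by any conjugate of it ([factorizationJ]).

    It remains to split P into classes of D.  All of P is one class of W, that
    of c = [1, ..., 1; (0 1 ... n-1)] ([std_ncycle_conj]), and D has index 2 in
    W, so everything depends on whether the centralizer of c in W lies in D.
    An element of it has constant signs.  If n is odd, [-1, ..., -1; 1] is in
    the centralizer but not in D, and P is one class of D ([ncycles_odd]).  If
    n is even, constant signs have product 1 and the centralizer lies in D
    ([cent_std_ncycle_sub]); conjugating c by an element outside D then yields
    a second class ([flip_class_neq], [ncycles_union]). *)

Local Open Scope group_scope.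

(** * Permutations with a single cycle *)

Definition full_cycle {T : finType} (s : {perm T}) :=
  porbits s == [set [set: T]].

Lemma full_cycleE {T : finType} (s : {perm T}) (x : T) :
  full_cycle s = (porbit s x == [set: T]).
Proof.
apply/eqP/eqP => [Es | Ex].
  by apply/set1P; rewrite -Es imset_f.
have Ey y : porbit s y = [set: T].
  by rewrite -Ex; apply/eqP; rewrite eq_porbit_mem Ex inE.
apply/setP=> A; rewrite inE; apply/imsetP/eqP => [[y _ ->] // | ->].
by exists x.
Qed.

Lemma full_cycle_reach {T : finType} {s : {perm T}} (x y : T) :
  full_cycle s -> exists i, y = (s ^+ i) x.
Proof.
by rewrite (full_cycleE s x) => /eqP Es; apply/porbitP; rewrite Es inE.
Qed.

Lemma full_cycleJ {T : finType} (s t : {perm T}) :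
  full_cycle s -> T -> full_cycle (s ^ t).
Proof.
move=> Fs x; rewrite (full_cycleE _ (t x)); apply/eqP/setP=> y; rewrite inE.
have [i Ei] := full_cycle_reach x (t^-1 y) Fs.
by apply/porbitP; exists i; rewrite -conjXg !permM permK -Ei permKV.
Qed.

(** The centralizer of a transitive cyclic group is regular: evaluation at a
    point [x] is injective on it, as a permutation commuting with [s] is
    determined by the image of [x], and the powers of [s] reach every point. *)
Lemma card_cent_full_cycle {T : finType} (s : {perm T}) (x : T) :
  full_cycle s -> #|'C[s]| = #|T|.
Proof.
move=> Fs; rewrite -cardsT.
suff <-: [set (t : {perm T}) x | t in 'C[s]] = [set: T].
  rewrite card_in_imset // => t u /cent1P Ct /cent1P Cu Etu.
  apply/permP=> y; have [i ->] := full_cycle_reach x y Fs.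
  by rewrite -!permM -(commuteX i Ct) -(commuteX i Cu) !permM Etu.
apply/setP=> y; rewrite inE; have [i ->] := full_cycle_reach x y Fs.
by apply/imsetP; exists (s ^+ i) => //; rewrite groupX ?cent1id.
Qed.

(** * The sign product and constant signs *)

Definition parity {n : nat} (g : signed_perm n) := sign_prod [set: 'I_n] g.

Lemma parityE {n : nat} (g : signed_perm n) :
  parity g = \big[addb/false]_i signs g i.
Proof. by rewrite /parity /sign_prod; apply: eq_bigl => i; rewrite inE. Qed.

Lemma parityM {n : nat} (g h : signed_perm n) :
  parity (g * h) = parity g (+) parity h.
Proof.
rewrite !parityE [X in _ = _ (+) X](reindex_inj (@perm_inj _ (uperm g))).
by rewrite -big_split /=; apply: eq_bigr => i _; rewrite ffunE.
Qed.

Lemma parity1 {n : nat} : parity (1 : signed_perm n) = false.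
Proof. by rewrite parityE big1 // => i _; rewrite ffunE. Qed.

Lemma parityV {n : nat} (g : signed_perm n) : parity g^-1 = parity g.
Proof. by have := parityM g^-1 g; rewrite mulVg parity1; do 2!case: parity. Qed.

Lemma parityJ {n : nat} (g h : signed_perm n) : parity (g ^ h) = parity g.
Proof. by rewrite !parityM parityV addbC addbK. Qed.

Lemma type_DE {n : nat} (g : signed_perm n) : (g \in type_D n) = ~~ parity g.
Proof. by rewrite inE eqbF_neg. Qed.

(** The argument is a pair so that the image of a product set [E * 'S_n] is the
    subgroup with constant signs taken in [E]. *)
Definition const_sperm {n : nat} (p : bool * 'S_n) : signed_perm n :=
  SignedPerm [ffun=> p.1] p.2.

Lemma const_spermM {n : nat} (e f : bool) (s t : 'S_n) :
  const_sperm (e, s) * const_sperm (f, t) = const_sperm (e (+) f, s * t).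
Proof. by apply: sperm_eqP => [i|] //; rewrite !ffunE. Qed.

Lemma const_sperm_inj {n : nat} : 0 < n -> injective (@const_sperm n).
Proof.
move=> n_gt0 [e s] [f t] E; congr pair; last exact: (congr1 (@uperm n) E).
by have /ffunP/(_ (Ordinal n_gt0)) := congr1 (@signs n) E; rewrite !ffunE.
Qed.

Lemma parity_const {n : nat} (p : bool * 'S_n) :
  parity (const_sperm p) = p.1 && odd n.
Proof.
rewrite parityE; under eq_bigr do rewrite ffunE.
by rewrite big_const_ord; case: p => [[] s] /=; elim: n {s} => //= n ->.
Qed.

(** * Conjugacy and number of the n-cycles *)

Definition std_cycle (n : nat) : 'S_n := perm (@ordS_inj n).

Definition std_ncycle (n : nat) : signed_perm n :=
  const_sperm (false, std_cycle n).

Lemma full_cycle_std {n : nat} (x : 'I_n) : full_cycle (std_cycle n).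
Proof.
have E i : (((std_cycle n) ^+ i) x : nat) = (x + i) %% n.
  elim: i => [|i IHi]; first by rewrite perm1 addn0 modn_small.
  by rewrite expgSr permM permE /= IHi -addn1 modnDml addn1 addnS.
rewrite (full_cycleE _ x); apply/eqP/setP=> y; rewrite inE.
apply/porbitP; exists (y + (n - x)); apply: val_inj; rewrite /= E.
by rewrite addnCA subnKC 1?ltnW // modnDr modn_small.
Qed.

(** A conjugator [a; s] from [std_ncycle n] to [q] is found by following the
    cycle of [q] from [x]: [s i] is the [i]-th point after [x], and [a i] is the
    product of the signs met on the way.  The relation to check between [i] and
    its successor holds by construction, except on returning to [x]; there it
    says that the total sign of [q] is 1. *)
Lemma std_ncycle_conj {n : nat} (x : 'I_n) (q : signed_perm n) :
  full_cycle (uperm q) -> ~~ parity q -> exists g, std_ncycle n ^ g = q.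
Proof.
set t := uperm q => Ft Pq.
have ot : #|porbit t x| = n.
  by move: Ft; rewrite (full_cycleE _ x) => /eqP->; rewrite cardsT card_ord.
have tn : (t ^+ n) x = x by rewrite permX; have := iter_porbit t x; rewrite ot.
have s_inj : injective (fun i : 'I_n => (t ^+ i) x).
  move=> i j /eqP; rewrite !permX.
  rewrite -(nth_traject t (ltn_ord i)) -(nth_traject t (ltn_ord j)).
  have Ut := uniq_traject_porbit t x; rewrite ot in Ut.
  by rewrite nth_uniq ?size_traject // => /eqP/val_inj.
pose a k := \big[addb/false]_(0 <= j < k) signs q ((t ^+ j) x).
have an : a n = false.
  apply/negbTE; move: Pq; rewrite /a big_mkord parityE.
  by rewrite (reindex_inj s_inj).
pose g := SignedPerm [ffun i : 'I_n => a i] (perm s_inj).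
exists g; apply/(canLR (mulKg g)); apply: sperm_eqP => [i|].
  rewrite !ffunE /= !permE.
  (* When i = n - 1, the successor is 0 and this is the equation a n = a 0. *)
  have ->: a (ordS i) = a i.+1.
    have := ltn_ord i; rewrite /= leq_eqVlt => /orP[/eqP-> | i_lt].
      by rewrite modnn an /a big_geq.
    by rewrite modn_small.
  by rewrite {1}/a big_nat_recr.
apply/permP=> i; rewrite /= !permM !permE /=.
rewrite -permM -expgSr.
have := ltn_ord i; rewrite leq_eqVlt => /orP[/eqP-> | i_lt].
  by rewrite modnn perm1 tn.
by rewrite modn_small.
Qed.

Lemma card_full_cycle (n : nat) (n_gt0 : 0 < n) :
  #|[set s : 'S_n | full_cycle s]| = (n.-1)`!.
Proof.
have x : 'I_n by apply: Ordinal n_gt0.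
pose c := std_cycle n.
have ->: [set s : 'S_n | full_cycle s] = c ^: [set: 'S_n].
  apply/setP=> s; rewrite inE; apply/idP/imsetP => [Fs | [t _ ->]].
    have [|g Eg] := std_ncycle_conj x (const_sperm (false, s)) Fs.
      by rewrite parity_const.
    exists (uperm g); first by rewrite inE.
    by rewrite -[LHS]/(uperm (const_sperm (false, s))) -Eg.
  exact: full_cycleJ (full_cycle_std x) x.
apply/eqP; rewrite -index_cent1 -(eqn_pmul2l n_gt0); apply/eqP.
rewrite -[X in (X * _)%N = _]card_ord.
rewrite -(card_cent_full_cycle c x (full_cycle_std x)).
rewrite -{1}(setTI 'C[c]) Lagrange ?subsetT // cardsT card_Sn.
by case: n n_gt0 {x c}.
Qed.

(** * The classes of signed partition (n) *)

Definition ncycles (n : nat) : {set signed_perm n} :=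
  [set g | full_cycle (uperm g) && ~~ parity g].

Lemma signed_partition_ncycles {n : nat} (g : signed_perm n) :
  0 < n -> perm_eq (signed_partition g) [:: (n, false)] = (g \in ncycles n).
Proof.
move=> n_gt0; rewrite inE; apply/idP/andP => [Pg | [/eqP Fg /negbTE Pg]].
  have /eqP/cards1P[A EA] : #|porbits (uperm g)| = 1%N.
    rewrite cardE -(size_map (fun C : {set _} => (#|C|, sign_prod C g))).
    by rewrite (perm_size Pg).
  move: Pg; rewrite /signed_partition /full_cycle EA enum_set1.
  move=> /perm_small_eq; move=> /(_ isT) [/eqP oA PA].
  have/eqP ET: A == [set: 'I_n].
    by rewrite eqEcard subsetT cardsT card_ord (eqP oA) leqnn.
  by rewrite -ET eqxx /parity -ET PA.
by rewrite /signed_partition Fg enum_set1 /= cardsT card_ord -/(parity g) Pg.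
Qed.

Lemma std_ncycle_in {n : nat} : 0 < n -> std_ncycle n \in ncycles n.
Proof.
by move=> n_gt0; rewrite inE (full_cycle_std (Ordinal n_gt0)) parity_const.
Qed.

Lemma ncyclesJ {n : nat} (g h : signed_perm n) :
  0 < n -> (g ^ h \in ncycles n) = (g \in ncycles n).
Proof.
move=> n_gt0; rewrite !inE parityJ; congr andb; apply/idP/idP => Fg.
  rewrite -[g](conjgK h); exact: full_cycleJ Fg (Ordinal n_gt0).
exact: full_cycleJ Fg (Ordinal n_gt0).
Qed.

Lemma ncycles_std_conj {n : nat} (g : signed_perm n) :
  0 < n -> g \in ncycles n -> exists h, g = std_ncycle n ^ h.
Proof.
move=> n_gt0; rewrite inE => /andP[Fg Pg].
by have [h <-] := std_ncycle_conj (Ordinal n_gt0) g Fg Pg; exists h.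
Qed.

Lemma class_sub_ncycles {n : nat} (g : signed_perm n) :
  0 < n -> (g ^: type_D n \subset ncycles n) = (g \in ncycles n).
Proof.
move=> n_gt0; apply/subsetP/idP => [sX | Xg _ /imsetP[h _ ->]].
  by apply: sX; apply: class_refl.
by rewrite ncyclesJ.
Qed.

Lemma classes_ncyclesE {n : nat} : 0 < n ->
  classes_of_signed_partition (type_D_group n) [:: (n, false)]
  = [set g ^: type_D n | g in ncycles n].
Proof.
move=> n_gt0; apply/setP=> X; rewrite inE.
have ->: [forall g in X, perm_eq (signed_partition g) [:: (n, false)]]
       = (X \subset ncycles n).
  apply/forall_inP/subsetP => XP g /XP; by rewrite signed_partition_ncycles.
apply/andP/imsetP => [[/imsetP[g Dg ->]] | [g Xg ->]].
  by rewrite class_sub_ncycles // => Xg; exists g.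
rewrite class_sub_ncycles //; split=> //; apply: mem_classes.
by move: Xg; rewrite inE type_DE => /andP[].
Qed.

(** A conjugator with sign product -1 can be corrected by the central element
    with all signs -1, which is not in the group of type D_n for odd [n]. *)
Lemma ncycles_odd {n : nat} :
  0 < n -> odd n -> ncycles n = std_ncycle n ^: type_D n.
Proof.
move=> n_gt0 n_odd; apply/eqP; rewrite eqEsubset class_sub_ncycles //.
rewrite std_ncycle_in // andbT.
apply/subsetP=> g /(ncycles_std_conj g n_gt0)[h ->].
have [Dh | Dh] := boolP (h \in type_D n); first exact: memJ_class.
pose z : signed_perm n := const_sperm (true, 1).
have zc : std_ncycle n ^ z = std_ncycle n.
  by apply/(canLR (mulKg z)); rewrite !const_spermM mulg1 mul1g.
rewrite -[X in X ^ h]zc -conjgM memJ_class // type_DE parityM.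
by move: Dh; rewrite type_DE negbK => ->; rewrite addbT negbK parity_const.
Qed.

(** Commuting with [std_ncycle n] forces the signs to be constant along the
    cycle, that is everywhere; an even number of equal signs has product 1. *)
Lemma cent_std_ncycle_sub {n : nat} :
  0 < n -> ~~ odd n -> 'C[std_ncycle n] \subset type_D n.
Proof.
move=> n_gt0 n_even; apply/subsetP=> g /cent1P Cg; rewrite type_DE.
pose x := Ordinal n_gt0.
have Cs i : signs g (std_cycle n i) = signs g i.
  have /(congr1 (fun h => signs h i)) := Cg.
  by rewrite /= !ffunE addbF addFb.
have Cx i : signs g i = signs g x.
  have [k ->] := full_cycle_reach x i (full_cycle_std x).
  by elim: k => [|k IHk]; rewrite ?perm1 // expgSr permM Cs.
have ->: g = const_sperm (signs g x, uperm g).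
  by apply: sperm_eqP => // i; rewrite ffunE Cx.
by rewrite parity_const (negbTE n_even) andbF.
Qed.

Definition flip {n : nat} (x : 'I_n) : signed_perm n :=
  SignedPerm [ffun i => i == x] 1.

Lemma parity_flip {n : nat} (x : 'I_n) : parity (flip x).
Proof.
rewrite parityE (bigD1 x) //= ffunE eqxx big1 // => i /negbTE ix.
by rewrite ffunE.
Qed.

(** Were the two classes equal, [flip x] would differ by an element of
    [type_D n] from an element centralizing [std_ncycle n], and so would be in
    [type_D n] itself. *)
Lemma flip_class_neq {n : nat} (x : 'I_n) : ~~ odd n ->
  std_ncycle n ^: type_D n != (std_ncycle n ^ flip x) ^: type_D n.
Proof.
move=> n_even; apply/eqP=> E.
have /imsetP[d Dd Ed]: std_ncycle n ^ flip x \in std_ncycle n ^: type_D n.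
  by rewrite E class_refl.
have: flip x * d^-1 \in 'C[std_ncycle n].
  by rewrite cent1C; apply/cent1P/commgP/conjg_fixP; rewrite conjgM Ed conjgK.
have n_gt0 : 0 < n by case: n x {n_even E d Dd Ed} => [[]|].
move/(subsetP (cent_std_ncycle_sub n_gt0 n_even)).
rewrite type_DE parityM parityV parity_flip.
by move: Dd; rewrite type_DE => /negbTE->.
Qed.

Lemma ncycles_union {n : nat} (x : 'I_n) :
  ncycles n
  = std_ncycle n ^: type_D n :|: (std_ncycle n ^ flip x) ^: type_D n.
Proof.
have n_gt0 : 0 < n by case: n x => [[]|].
apply/eqP; rewrite eqEsubset subUset !class_sub_ncycles // ncyclesJ //.
rewrite std_ncycle_in // !andbT.
apply/subsetP=> g /(ncycles_std_conj g n_gt0)[h ->].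
rewrite inE; have [Dh | Dh] := boolP (h \in type_D n).
  by rewrite memJ_class.
rewrite -[h](mulKVg (flip x)) conjgM [X in _ || X]memJ_class ?orbT //.
rewrite type_DE parityM parityV parity_flip.
by move: Dh; rewrite type_DE negbK => ->.
Qed.

(** * The subgroups with constant signs *)

Lemma pm_SymE (n : nat) :
  pm_Sym n = const_sperm @: setX [set: bool] [set: 'S_n].
Proof.
apply/setP=> g; rewrite inE; apply/orP/imsetP => [[] /eqP Eg | [[[] s] _ ->]].
- by exists (false, uperm g); [rewrite !inE | apply: sperm_eqP; rewrite //= Eg].
- by exists (true, uperm g); [rewrite !inE | apply: sperm_eqP; rewrite //= Eg].
- by right.
by left.
Qed.

Lemma pure_SymE (n : nat) :
  pure_Sym n = const_sperm @: setX [set false] [set: 'S_n].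
Proof.
apply/setP=> g; rewrite inE; apply/eqP/imsetP => [Eg | [[e s]]].
  by exists (false, uperm g); [rewrite !inE | apply: sperm_eqP; rewrite //= Eg].
by rewrite !inE => /andP[/eqP/= -> _] ->.
Qed.

Lemma pm_Sym_isog (n : nat) : 0 < n -> [set: 'Z_2 * 'S_n] \isog pm_Sym n.
Proof.
(* The group law of the ring 'Z_2 is its addition, so b is a morphism. *)
move=> n_gt0; pose b (z : 'Z_2) := z != 0%R.
have bM (y z : 'Z_2) : b (y * z) = b y (+) b z.
  by case: y z => [[|[|k]] ?] // [[|[|l]] ?].
have b_inj : injective b.
  by move=> [[|[|k]] ?] [[|[|l]] ?] //= _; apply: val_inj.
pose f (p : 'Z_2 * 'S_n) := const_sperm (b p.1, p.2).
have fM : {in [set: 'Z_2 * 'S_n] &, {morph f : p q / p * q}}.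
  by move=> p q _ _; rewrite const_spermM -bM.
apply: (@isom_isog _ _ _ _ _ (Morphism fM)) => //; apply/isomP; split.
  apply/injmP=> [[y s] [z t] _ _] /(const_sperm_inj n_gt0)[/b_inj -> ->] //.
rewrite morphimEdom /= pm_SymE; apply/setP=> g.
apply/imsetP/imsetP => [[p _ ->]|].
  by exists (b p.1, p.2); rewrite ?inE.
case=> [[e s] _ ->]; exists (if e then 1%R else 0%R, s); first by rewrite inE.
by case: e.
Qed.

Lemma pure_Sym_isog (n : nat) : 0 < n -> [set: 'S_n] \isog pure_Sym n.
Proof.
move=> n_gt0; pose f (s : 'S_n) := const_sperm (false, s).
have fM : {in [set: 'S_n] &, {morph f : p q / p * q}}.
  by move=> p q _ _; rewrite const_spermM.
apply: (@isom_isog _ _ _ _ _ (Morphism fM)) => //; apply/isomP; split.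
  by apply/injmP=> s t _ _ /(const_sperm_inj n_gt0)[].
rewrite morphimEdom /= pure_SymE; apply/setP=> g.
apply/imsetP/imsetP => [[s _ ->]|]; first by exists (false, s); rewrite ?inE.
case=> [[e s]]; rewrite !inE => /andP[/eqP/= -> _] ->.
by exists s; rewrite ?inE.
Qed.

(** * Counting the factorizations *)

Lemma factorizationJ {gT : finGroupType} (r : nat) (G : {group gT})
    (A B : {set gT}) (x : gT) :
  x \in G -> B :^ x = B -> factorization r G A B ->
  factorization r G (A :^ x) B.
Proof.
move=> Gx Bx [r_gt0 sAG sBG rP]; split=> //.
  by rewrite -(conjGid Gx) conjSg.
move=> g Gg; rewrite -(rP (g ^ x^-1)) ?groupJ ?groupV //.
pose c (p : gT * gT) := (p.1 ^ x, p.2 ^ x).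
have c_inj : injective c.
  by move=> [a b] [a' b'] [/conjg_inj-> /conjg_inj->].
rewrite -[RHS](card_imset _ c_inj); apply: eq_card => -[a b].
rewrite inE in_setX /=; apply/andP/imsetP.
  rewrite -{1}Bx !mem_conjg => -[/andP[Aa Bb] /eqP Eg].
  exists (a ^ x^-1, b ^ x^-1); last by rewrite /c /= !conjgKV.
  by rewrite inE in_setX /= Aa Bb -conjMg Eg eqxx.
case=> [[u v]]; rewrite inE in_setX /= => /andP[/andP[Au Bv] /eqP Eg] [-> ->].
by rewrite -Bx !memJ_conjg Au Bv -conjMg Eg conjgKV.
Qed.

(** The first factor [h] of [g] can be chosen with any constant sign in [E] and
    any permutation making that of [h^-1 * g] an n-cycle [s], namely that of
    [g] times [s^-1]; the sign condition on [h^-1 * g] follows from membership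
    in [type_D n]. *)
Lemma factorization_const {n : nat} (n_gt0 : 0 < n) (E : {set bool}) :
  E != set0 -> const_sperm @: setX E [set: 'S_n] \subset type_D n ->
  factorization (#|E| * (n.-1)`!)%N (type_D_group n)
    (const_sperm @: setX E [set: 'S_n]) (ncycles n).
Proof.
move=> E_n0 sKD; split=> //.
- by rewrite muln_gt0 card_gt0 E_n0 fact_gt0.
- by apply/subsetP=> g; rewrite inE type_DE => /andP[].
move=> g Dg; rewrite -(card_full_cycle n n_gt0) -cardsX.
pose h (p : bool * 'S_n) := const_sperm (p.1, uperm g * p.2^-1).
pose f p := (h p, (h p)^-1 * g).
have f_inj : injective f.
  move=> [e s] [e' s'] /(congr1 fst)/(const_sperm_inj n_gt0)[->].
  by move/mulgI/invg_inj->.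
rewrite -[RHS](card_imset _ f_inj); apply: eq_card => -[a b].
rewrite inE in_setX; apply/andP/imsetP.
  case=> /andP[/imsetP[[e s]]]; rewrite inE /= => /andP[Ee _] ->.
  rewrite inE => /andP[Fb _] /eqP Eg; exists (e, uperm b).
    by rewrite in_setX Ee inE.
  have hE: h (e, uperm b) = const_sperm (e, s).
    by rewrite /h -Eg /= mulgK.
  by rewrite /f hE -Eg mulKg.
case=> [[e s]]; rewrite in_setX inE => /andP[Ee Fs] [-> ->].
have Kh: h (e, s) \in const_sperm @: setX E [set: 'S_n].
  by apply: imset_f; rewrite in_setX Ee inE.
rewrite Kh mulKVg eqxx; split=> //; rewrite /= inE; apply/andP; split.
  change (full_cycle ((uperm g * s^-1)^-1 * uperm g)).
  by rewrite invMg invgK mulgKV.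
by rewrite -type_DE groupM ?groupV // (subsetP sKD).
Qed.

Lemma ncycles_conj {n : nat} (x : signed_perm n) :
  0 < n -> ncycles n :^ x = ncycles n.
Proof. by move=> n_gt0; apply/setP=> g; rewrite mem_conjg ncyclesJ. Qed.

Theorem corollary4p3 (n : nat) (n_gt0 : (0 < n)%N) :
  (~~ odd n ->
     exists X1 X2 : {set signed_perm n},
       [/\ X1 != X2,
           classes_of_signed_partition (type_D_group n) [:: (n, false)]
             = [set X1; X2]
         & forall H : {group signed_perm n},
             (H : {set signed_perm n}) \in pm_Sym n :^: type_D n ->
             H \isog [set: 'Z_2 * 'S_n]
             /\ factorization (2 * (n.-1)`!)%N (type_D_group n) H (X1 :|: X2)])
  /\
  (odd n ->
     exists X1 : {set signed_perm n},
       classes_of_signed_partition (type_D_group n) [:: (n, false)] = [set X1]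
       /\ forall H : {group signed_perm n},
            (H : {set signed_perm n}) \in pure_Sym n :^: type_D n ->
            H \isog [set: 'S_n]
            /\ factorization (n.-1)`! (type_D_group n) H X1).
Proof.
split=> [n_even | n_odd].
  pose x := Ordinal n_gt0.
  exists (std_ncycle n ^: type_D n), ((std_ncycle n ^ flip x) ^: type_D n).
  split; first exact: flip_class_neq.
    rewrite classes_ncyclesE //; apply/setP=> X; rewrite !inE.
    apply/imsetP/orP => [[g] | ].
      by rewrite (ncycles_union x) inE => /orP[] /class_eqP-> ->;
        [left | right].
    by case=> /eqP->; [exists (std_ncycle n) | exists (std_ncycle n ^ flip x)];
      rewrite ?ncyclesJ // std_ncycle_in.
  move=> H /imsetP[d Dd HE]; split.
    rewrite HE isog_sym; apply: isog_trans (pm_Sym_isog n n_gt0) _.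
    exact: conj_isog.
  rewrite -ncycles_union HE; apply: factorizationJ => //.
    exact: ncycles_conj.
  rewrite pm_SymE -card_bool -cardsT; apply: factorization_const => //.
    by apply/set0Pn; exists true; rewrite inE.
  apply/subsetP=> _ /imsetP[p _ ->].
  by rewrite type_DE parity_const (negbTE n_even) andbF.
exists (ncycles n); split.
  rewrite classes_ncyclesE //; apply/setP=> X; rewrite inE.
  apply/imsetP/eqP => [[g] | ->].
    by rewrite ncycles_odd // => /class_eqP-> ->.
  by exists (std_ncycle n); rewrite ?std_ncycle_in // ncycles_odd.
move=> H /imsetP[d Dd HE]; split.
  rewrite HE isog_sym; apply: isog_trans (pure_Sym_isog n n_gt0) _.
  exact: conj_isog.
rewrite HE; apply: factorizationJ => //; first exact: ncycles_conj.
rewrite pure_SymE -[(n.-1)`!]mul1n -(cards1 false).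
apply: factorization_const => //.
  by apply/set0Pn; exists false; rewrite inE.
apply/subsetP=> g /imsetP[[e s]]; rewrite !in_setX inE => /andP[/eqP/= -> _] ->.
by rewrite type_DE parity_const.
Qed.
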